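(* Let $f:[0,\infty)\to[0,\infty)$. Then $f$ is ultrametric-preserving if and only if $f$ is amenable and increasing on $[0,\infty)$.
   Context: An ultrametric space is a metric space $(X,d)$ satisfying $d(x,y)\leq \max\{d(x,z),d(z,y)\}$ for all $x,y,z\in X$; then $d$ is called an ultrametric. A function $f:[0,\infty)\to[0,\infty)$ is ultrametric-preserving if for all ultrametric spaces $(X,d)$, $f\circ d$ is an ultrametric on $X$. $f$ is amenable if $f^{-1}(\{0\})=\{0\}$. $f$ is increasing on $I\subseteq[0,\infty)$ if $f(x)\leq f(y)$ for all $x,y\in I$ with $x<y$ (non-strict). *)

(* Defs.v *)
From mathcomp Require Import all_boot all_order all_algebra.
From mathcomp Require Import interval_inference.
From mathcomp Require Import boolp classical_sets reals.

Set Implicit Arguments.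
Unset Strict Implicit.
Unset Printing Implicit Defensive.

Import Order.TTheory GRing.Theory Num.Theory.
Local Open Scope classical_set_scope.
Local Open Scope ring_scope.

(* Distances take values in [{nonneg R}], i.e. [0, +oo), so nonnegativity is
   part of the typing. The library's [metricType] bundles one distance with its
   carrier, whereas here [d] and [f] o [d] live on the same carrier; hence
   predicates on distance functions. *)
Record is_metric (R : realType) (X : Type) (d : X -> X -> {nonneg R}) : Prop :=
  IsMetric {
    metric_eq0 : forall x y, d x y = 0%:nng <-> x = y ;
    metric_symm : forall x y, d x y = d y x ;
    metric_triangle_ineq :
      forall x y z, (d x z)%:num <= (d x y)%:num + (d y z)%:num
  }.

Definition is_ultrametric (R : realType) (X : Type)
    (d : X -> X -> {nonneg R}) : Prop :=
  is_metric d /\ forall x y z, d x y <= Num.max (d x z) (d z y).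

Definition ultrametric_preserving (R : realType)
    (f : {nonneg R} -> {nonneg R}) : Prop :=
  forall (X : Type) (d : X -> X -> {nonneg R}),
    is_ultrametric d -> is_ultrametric (fun x y => f (d x y)).

Definition amenable (R : realType) (f : {nonneg R} -> {nonneg R}) : Prop :=
  f @^-1` [set 0%:nng] = [set 0%:nng].

Definition increasing_on (R : realType) (I : set {nonneg R})
    (f : {nonneg R} -> {nonneg R}) : Prop :=
  forall x y, I x -> I y -> x < y -> f x <= f y.

(* Main.v *)
Require Import Defs.
From mathcomp Require Import all_boot all_order all_algebra.
From mathcomp Require Import interval_inference.
From mathcomp Require Import boolp classical_sets reals.
Local Open Scope classical_set_scope.
Local Open Scope ring_scope.

(** An increasing f commutes with max, so f o d inherits the ultrametric
    inequality, and amenability gives separation. Conversely, a single test space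
    suffices: [0, +oo) with d(x, y) = max(x, y) for x <> y. Since d(0, x) = x,
    separation of f o d gives amenability of f; and for a < b the points 0, a, b
    have distances d(0, a) = a and d(0, b) = d(b, a) = b, so the ultrametric
    inequality for f o d reads f a <= f b. *)

Import Order.TTheory GRing.Theory Num.Theory.

(* The triangle inequality is automatic, since max(a, b) <= a + b. *)
Lemma is_ultrametric_of_max (R : realType) (X : Type)
    (d : X -> X -> {nonneg R}) :
  (forall x y, d x y = 0%:nng <-> x = y) ->
  (forall x y, d x y = d y x) ->
  (forall x y z, d x y <= Num.max (d x z) (d z y)) ->
  is_ultrametric d.
Proof.
move=> d0 dC dmax; split=> //; split=> // x y z.
have := dmax x z y; rewrite le_max => /orP[] dxz.
- by apply: le_trans (_ : (d x y)%:num <= _); rewrite // lerDl.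
- by apply: le_trans (_ : (d y z)%:num <= _); rewrite // lerDr.
Qed.

Definition max_dist (R : realType) (x y : {nonneg R}) : {nonneg R} :=
  if x == y then 0%:nng else Num.max x y.

Lemma max_dist0l (R : realType) (x : {nonneg R}) : max_dist R 0%:nng x = x.
Proof.
rewrite /max_dist; case: eqP => // _; apply/max_idPr.
exact: (ge0 x).
Qed.

Lemma max_dist_lt (R : realType) (x y : {nonneg R}) :
  x < y -> max_dist R y x = y.
Proof. by move=> xy; rewrite /max_dist gt_eqF// (max_idPl (ltW xy)). Qed.

Lemma max_dist_ultrametric (R : realType) : is_ultrametric (max_dist R).
Proof.
have nng_ge0 (x : {nonneg R}) : 0%:nng <= x by exact: (ge0 x).
apply: is_ultrametric_of_max => [x y|x y|x y z]; rewrite /max_dist.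
- case: eqP => // xy; split=> // m0; case: xy.
  have /andP[x0 y0] : (x <= 0%:nng) && (y <= 0%:nng) by rewrite -ge_max m0.
  by apply: le_anti; rewrite (le_trans x0)// (le_trans y0).
- by rewrite eq_sym maxC.
- case: (eqVneq x y) => [_|xy]; first exact: nng_ge0.
  (* If [z] is [x] or [y], one distance on the right equals the left side; otherwise all three are
     maxima, and [x] and [y] both occur on the right. *)
  case: (eqVneq x z) => [<-|xz]; first by rewrite (negPf xy) le_max lexx orbT.
  case: (eqVneq z y) => [->|zy]; first by rewrite le_max lexx.
  by rewrite ge_max !le_max !lexx /= !orbT.
Qed.

Theorem theorem9 (R : realType) (f : {nonneg R} -> {nonneg R}) :
  ultrametric_preserving f <-> (amenable f /\ increasing_on setT f).
Proof.
split=> [fP|[f0 fI] X d [[d0 dC _] dmax]].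
- have [[fd0 _ _] fdmax] := fP _ _ (max_dist_ultrametric R).
  split=> [|a b _ _ ab].
    apply/seteqP; split=> x /=.
    + by move=> fx0; apply/esym/fd0; rewrite max_dist0l.
    (* Here 0 is read as the distance from 0 to itself. *)
    + by move=> ->; rewrite -{1}(max_dist0l R 0%:nng); apply/fd0.
  rewrite -(max_dist0l R a); apply: le_trans (fdmax _ _ b) _.
  by rewrite max_dist0l max_dist_lt// maxxx.
- have f_le a b : a <= b -> f a <= f b.
    by rewrite le_eqVlt => /orP[/eqP->//|]; exact: fI.
  have f0E a : f a = 0%:nng <-> a = 0%:nng.
    (* [f a = 0] is convertible to membership in the preimage, which [f0] rewrites. *)
    by rewrite -[f a = _]/((f @^-1` [set 0%:nng]) a) f0.
  apply: is_ultrametric_of_max => [x y|x y|x y z].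
  + by rewrite f0E.
  + by rewrite dC.
  (* [d x y] lies below one of the two distances; monotonicity is applied to that one. *)
  + by have := dmax x y z; rewrite !le_max => /orP[]/f_le ->; rewrite ?orbT.
Qed.
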